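(* Let $K$ be a fan-like simplicial sphere and $v$ a vertex of $K$. Let $(\operatorname{wed}_v(K),\lambda)$ be a characteristic map over $\mathbb{Z}_2$ and let $v_1,v_2$ be the two new vertices of $\operatorname{wed}_v(K)$ created by the wedging. Then $\lambda$ is uniquely determined by the projections $\operatorname{proj}_{v_1}\lambda$ and $\operatorname{proj}_{v_2}\lambda$. Furthermore, $\lambda$ is non-singular if and only if both $\operatorname{proj}_{v_1}\lambda$ and $\operatorname{proj}_{v_2}\lambda$ are non-singular.
   Context: Simplicial wedge: for a simplicial complex $K$ on vertex set $V$ and a vertex $v$, let $I$ be a 1-simplex on new vertices $v_1,v_2$ with 0-skeleton $\partial I$; $\operatorname{wed}_v(K)=(I\star\operatorname{link}_K\{v\})\cup(\partial I\star(K\setminus\{v\}))$, where $\star$ is the join, $\operatorname{link}_K\sigma=\{\tau\in K:\sigma\cup\tau\in K,\ \sigma\cap\tau=\varnothing\}$, and $K\setminus\{v\}$ is the induced subcomplex on $V\setminus\{v\}$. A simplicial $(n-1)$-sphere is fan-like if it underlies a complete simplicial fan in $\mathbb{R}^n$. A characteristic map over $\mathbb{Z}_2$ of dimension $n$ is a pair $(K,\lambda)$, $K$ a simplicial complex of dimension $\le n-1$, $\lambda:V(K)\to\mathbb{Z}_2^n$; it is non-singular if $\{\lambda(i):i\in\sigma\}$ is linearly independent over $\mathbb{Z}_2$ for every face $\sigma$. For a face $\sigma$ on which $\lambda$ is linearly independent, $\operatorname{proj}_\sigma\lambda$ is the map on vertices of $\operatorname{link}_K\sigma$ given by $w\mapsto[\lambda(w)]\in\mathbb{Z}_2^n/\langle\lambda(i):i\in\sigma\rangle$.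 Characteristic maps are considered up to $GL_n(\mathbb{Z}_2)$ acting on the target (Davis–Januszkiewicz equivalence). *)

(* Defs.v *)
From HB Require Import structures.
From mathcomp Require Import all_boot all_order all_algebra all_field.
From mathcomp Require Import Rstruct.
From Stdlib Require Rdefinitions.
Notation R := Rdefinitions.R.
Set Implicit Arguments. Unset Strict Implicit. Unset Printing Implicit Defensive.
Import Order.TTheory GRing.Theory Num.Theory.
Local Open Scope ring_scope.

Definition simplicial_complex (V : finType) (K : {set {set V}}) : Prop :=
  set0 \in K /\ forall s t : {set V}, s \in K -> t \subset s -> t \in K.

Definition vertices (V : finType) (K : {set {set V}}) : {set V} :=
  [set x | [set x] \in K].

Definition link (V : finType) (K : {set {set V}}) (s : {set V}) : {set {set V}} :=
  [set t in K | (s :|: t \in K) && [disjoint s & t]].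

Definition del (V : finType) (K : {set {set V}}) (v : V) : {set {set V}} :=
  [set s in K | v \notin s].

Definition join (V : finType) (A : {set {set V}}) (B : {set {set bool}})
  : {set {set (V + bool)}} :=
  [set (inl @: (a : {set V})) :|: (inr @: (b : {set bool})) | a in A, b in B].

(* I : the 1-simplex on the new vertices v1 = inr false, v2 = inr true;
   dI : its 0-skeleton *)
Definition I1 : {set {set bool}} := powerset [set: bool].
Definition dI1 : {set {set bool}} := [set set0; [set false]; [set true]].

Definition v1 (V : Type) : V + bool := inr false.
Definition v2 (V : Type) : V + bool := inr true.

(* wed_v(K) = (I * link_K {v}) u (dI * (K \ {v})) *)
Definition wedge (V : finType) (K : {set {set V}}) (v : V) : {set {set (V + bool)}} :=
  join (link K [set v]) I1 :|: join (del K v) dI1.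

Definition in_cone (V : finType) (n : nat) (p : V -> 'rV[R]_n) (s : {set V})
  (x : 'rV[R]_n) : Prop :=
  exists t : V -> R, (forall i, 0 <= t i) /\ x = \sum_(i in s) t i *: p i.

(* K underlies a complete simplicial fan in R^n, the ray of vertex i being
   spanned by p i: the generators of each cone are linearly independent,
   two cones meet in the cone of the common face, and the cones cover R^n. *)
Definition fan_like (V : finType) (K : {set {set V}}) (n : nat) : Prop :=
  exists p : V -> 'rV[R]_n,
    [/\ (forall s, s \in K -> forall c : V -> R,
            \sum_(i in s) c i *: p i = 0 -> forall i, i \in s -> c i = 0),
        (forall s t, s \in K -> t \in K -> forall x,
            in_cone p s x -> in_cone p t x -> in_cone p (s :&: t) x) &
        (forall x, exists2 s, s \in K & in_cone p s x)].

Definition span_of (T : finType) (d : nat) (lam : T -> 'rV['F_2]_d) (s : {set T})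
  : 'M['F_2]_d := (\sum_(i in s) <<lam i>>)%MS.

Definition indep_mod (T : finType) (d : nat) (U : 'M['F_2]_d) (t : {set T})
  (lam : T -> 'rV['F_2]_d) : Prop :=
  forall c : T -> 'F_2, ((\sum_(w in t) c w *: lam w)%R <= U)%MS ->
    forall w, w \in t -> c w = 0.

(* lam is linearly independent on the face s (so proj_s lam is defined) *)
Definition indep_on (T : finType) (d : nat) (lam : T -> 'rV['F_2]_d) (s : {set T})
  : Prop := indep_mod (0 : 'M['F_2]_d) s lam.

Definition nonsingular (T : finType) (d : nat) (K : {set {set T}})
  (lam : T -> 'rV['F_2]_d) : Prop :=
  forall s, s \in K -> indep_on lam s.

(* proj_s lam : w |-> [lam w] in 'F_2^d / <lam(s)>, on the vertices of link_K s;
   it is non-singular iff its values on each face of the link are independent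
   in the quotient *)
Definition proj_nonsingular (T : finType) (d : nat) (K : {set {set T}})
  (s : {set T}) (lam : T -> 'rV['F_2]_d) : Prop :=
  forall t, t \in link K s -> indep_mod (span_of lam s) t lam.

Definition DJ_equiv (T : finType) (d : nat) (K : {set {set T}})
  (lam lam' : T -> 'rV['F_2]_d) : Prop :=
  exists2 g : 'M['F_2]_d, g \in unitmx &
    forall x, x \in vertices K -> lam' x = lam x *m g.

(* DJ equivalence of proj_s lam and proj_s lam': a linear isomorphism
   'F_2^d/<lam(s)> -> 'F_2^d/<lam'(s)> carrying [lam w] to [lam' w] for every
   vertex w of link_K s; written via a lift g in GL_d mapping <lam(s)> onto
   <lam'(s)> (every isomorphism of the quotients lifts to such a g). *)
Definition proj_DJ_equiv (T : finType) (d : nat) (K : {set {set T}})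
  (s : {set T}) (lam lam' : T -> 'rV['F_2]_d) : Prop :=
  exists2 g : 'M['F_2]_d, g \in unitmx &
    (span_of lam s *m g == span_of lam' s)%MS /\
    forall w, w \in vertices (link K s) ->
      (lam w *m g - lam' w <= span_of lam' s)%MS.

(* Main.v *)
Require Import Defs.
From HB Require Import structures.
From mathcomp Require Import all_boot all_order all_algebra all_field.
From mathcomp Require Import zify.
Set Implicit Arguments. Unset Strict Implicit. Unset Printing Implicit Defensive.
Import GRing.Theory.
Local Open Scope ring_scope.

(* The new vertices v1, v2 of wed_v(K) are adjacent to every other vertex, so
   every vertex x other than v_i lies in the link of v_i.  A DJ equivalence of
   the projections at v1 thus yields g1 in GL_d with
   lam' x = lam x g1 + e1(x) lam'(v1) for all vertices x, and similarly at v2.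
   Pushing a linear relation among the lam x through both descriptions makes
   one vector a multiple of lam'(v1) and of lam'(v2); as lam(v1), lam(v2) are
   independent, both multiples vanish, so e1 is induced by a linear functional
   f and g1 + f lam'(v1) is the required element of GL_d.
   For non-singularity, every face of wed_v(K) is a face t of the link of some
   v_i or such a t together with v_i, and lam is independent on t u {v_i} iff
   [lam t] is independent modulo lam(v_i). *)

Section LinearFunctionals.
Variable F : fieldType.

Lemma solve_of_kermx m n (A : 'M[F]_(m, n)) (E : 'cV_m) :
  kermx A *m E = 0 -> exists f : 'cV_n, A *m f = E.
Proof.
move=> kerAE; pose B := row_mx A E.
have kerAB : (kermx A <= kermx B)%MS.
  by apply/sub_kermxP; rewrite mul_mx_row mulmx_ker kerAE row_mx0.
have rankB : (\rank (A^T + E^T) <= \rank A^T)%N.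
  rewrite addsmxE -tr_row_mx !mxrank_tr -/B.
  have := mxrankS kerAB; rewrite !mxrank_ker.
  have := rank_leq_row A; have := rank_leq_row B; lia.
have : (A^T + E^T <= A^T)%MS.
  by rewrite -(mxrank_leqif_sup (addsmxSl A^T E^T)).2 eqn_leq rankB mxrankS ?addsmxSl.
rewrite addsmx_sub => /andP [_ sEA].
exists (E^T *m pinvmx A^T)^T.
by apply: trmx_inj; rewrite trmx_mul trmxK mulmxKpV.
Qed.

Lemma functional_of_relations (T : finType) d (a : T -> 'rV[F]_d) (e : T -> F) :
  (forall c : T -> F, \sum_x c x *: a x = 0 -> \sum_x c x * e x = 0) ->
  exists f : 'cV_d, forall x, a x *m f = (e x)%:M.
Proof.
move=> rels.
pose A := \matrix_(i < #|T|) a (enum_val i); pose E := \col_(i < #|T|) e (enum_val i).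
have rowA x : row (enum_rank x) A = a x by rewrite rowK enum_rankK.
have comb (r : 'rV_#|T|) :
    r *m A = \sum_x r 0 (enum_rank x) *: a x /\
    r *m E = (\sum_x r 0 (enum_rank x) * e x)%:M.
  rewrite (mulmx_sum_row r A) (mulmx_sum_row r E) raddf_sum.
  rewrite !(reindex _ (onW_bij _ (@enum_rank_bij T))) /=.
  split; apply: eq_bigr => x _; rewrite ?rowA //.
  by apply/rowP => j; rewrite !mxE ord1 enum_rankK mulr1n.
have [f Af] : exists f, A *m f = E.
  apply: solve_of_kermx; apply/row_matrixP => i.
  rewrite row_mul row0; have [rA rE] := comb (row i (kermx A)).
  by rewrite rE rels ?raddf0 // -rA -row_mul mulmx_ker row0.
exists f => x; rewrite -rowA -row_mul Af.
by apply/rowP => j; rewrite !mxE ord1 enum_rankK mulr1n.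
Qed.

Lemma functional_of_relations_in (T : finType) d (X : {set T})
    (a : T -> 'rV[F]_d) (e : T -> F) :
  (forall c : T -> F, \sum_(x in X) c x *: a x = 0 -> \sum_(x in X) c x * e x = 0) ->
  exists f : 'cV_d, {in X, forall x, a x *m f = (e x)%:M}.
Proof.
move=> rels; pose aX x := if x \in X then a x else 0.
pose eX x := if x \in X then e x else 0.
have [|f Af] := @functional_of_relations T d aX eX.
  move=> c; under eq_bigr => x _ do rewrite /aX (fun_if ( *:%R (c x))) scaler0.
  rewrite -big_mkcond => /rels sum0; rewrite -{}[RHS]sum0 [RHS]big_mkcond.
  by apply: eq_bigr => x _; rewrite /eX; case: ifP; rewrite ?mulr0.
by exists f => x xX; have := Af x; rewrite /aX /eX xX.
Qed.

End LinearFunctionals.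

Section IndependenceF2.
Variables (T : finType) (d : nat) (lam : T -> 'rV['F_2]_d).
Implicit Types (a b w : T) (s t : {set T}).

Lemma F2_neq0 (k : 'F_2) : k != 0 -> k = 1.
Proof. by case: k => [[|[|]]] //= lt_k _; apply/val_inj. Qed.

Lemma span_of_set1 a : span_of lam [set a] = <<lam a>>%MS.
Proof. by rewrite /span_of big_set1. Qed.

Lemma sub_span_of_set1P a y :
  reflect (exists k, y = k *: lam a) (y <= span_of lam [set a])%MS.
Proof. by rewrite span_of_set1 genmxE; apply: sub_rVP. Qed.

Lemma indep_on_set1_neq0 a : indep_on lam [set a] -> lam a != 0.
Proof.
move=> indep_a; apply/eqP => lam_a0.
have := indep_a (fun _ => 1); rewrite big_set1 lam_a0 scaler0 sub0mx.
by move=> /(_ isT a (set11 a)) /eqP; rewrite oner_eq0.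
Qed.

Lemma indep_on_set2 a b k l : a != b -> indep_on lam [set a; b] ->
  k *: lam a + l *: lam b = 0 -> k = 0 /\ l = 0.
Proof.
move=> neq_ab indep_ab comb0.
have neq_ba : b != a by rewrite eq_sym.
have := indep_ab (fun x => if x == a then k else l).
rewrite big_setU1 ?inE //= big_set1 eqxx (negbTE neq_ba) comb0 sub0mx => /(_ isT) c0.
by split; [have := c0 a | have := c0 b]; rewrite !inE eqxx ?orbT ?(negbTE neq_ba); apply.
Qed.

Lemma indep_onS s t : t \subset s -> indep_on lam s -> indep_on lam t.
Proof.
move=> sub_ts indep_s c sum_t w w_t; pose c' x := if x \in t then c x else 0.
have sum_c' : \sum_(x in t) c' x *: lam x = \sum_(x in t) c x *: lam x.
  by apply: eq_bigr => x x_t; rewrite /c' x_t.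
have rest0 : \sum_(x in s :\: t) c' x *: lam x = 0.
  by apply: big1 => x; rewrite inE /c' => /andP [/negbTE -> _]; rewrite scale0r.
have := indep_s c'; rewrite (big_setID t) /= (setIidPr sub_ts) sum_c' rest0 addr0.
by move=> /(_ sum_t w (subsetP sub_ts w w_t)); rewrite /c' w_t.
Qed.

Lemma indep_on_of_mod (U : 'M_d) t : indep_mod U t lam -> indep_on lam t.
Proof. by move=> indep_t c sub_c; apply/indep_t/(submx_trans sub_c)/sub0mx. Qed.

Lemma indep_mod_of_setU1 a t :
  a \notin t -> indep_on lam (a |: t) -> indep_mod (span_of lam [set a]) t lam.
Proof.
move=> a_t indep_at c /sub_span_of_set1P [k sum_c] w w_t.
pose c' x := if x == a then - k else c x.
have c'_t : {in t, c' =1 c}.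
  by move=> x x_t; rewrite /c'; case: eqP => // xa; rewrite -xa x_t in a_t.
have sum_c' : \sum_(x in t) c' x *: lam x = \sum_(x in t) c x *: lam x.
  by apply: eq_bigr => x /c'_t ->.
have := indep_at c'; rewrite big_setU1 //= sum_c' sum_c {1}/c' eqxx scaleNr addNr sub0mx.
by move=> /(_ isT w (setU1r _ w_t)); rewrite c'_t.
Qed.

Lemma indep_on_setU1 a t : a \notin t ->
  indep_on lam [set a] -> indep_mod (span_of lam [set a]) t lam -> indep_on lam (a |: t).
Proof.
move=> a_t indep_a indep_t c; rewrite big_setU1 //= submx0 => /eqP sum_c.
have sum_t : \sum_(y in t) c y *: lam y = (- c a) *: lam a.
  by apply/eqP; rewrite scaleNr -addr_eq0 addrC sum_c.
have c_t : {in t, forall w, c w = 0}.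
  by apply: indep_t; apply/sub_span_of_set1P; exists (- c a).
have c_a : c a = 0.
  apply: (indep_a c); last exact: set11.
  by rewrite big_set1 submx0 -sum_c big1 ?addr0 // => y /c_t ->; rewrite scale0r.
by move=> w /setU1P [-> // | /c_t].
Qed.

End IndependenceF2.

Section Projections.
Variables (T : finType) (d : nat).
Implicit Types (K : {set {set T}}) (a : T) (t : {set T}) (lam : T -> 'rV['F_2]_d).

Lemma in_link1 K a t :
  (t \in link K [set a]) = [&& t \in K, a |: t \in K & a \notin t].
Proof. by rewrite in_set disjoints1. Qed.

Lemma in_vertices K x : (x \in vertices K) = ([set x] \in K).
Proof. by rewrite in_set. Qed.

Lemma nonsingular_proj K a lam :
  nonsingular K lam -> proj_nonsingular K [set a] lam.
Proof.
move=> ns t; rewrite in_link1 => /and3P [_ at_K a_t].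
by apply: indep_mod_of_setU1 a_t _; apply: ns.
Qed.

Lemma proj_nonsingular_indep K a t lam :
  indep_on lam [set a] -> proj_nonsingular K [set a] lam -> t \in link K [set a] ->
  indep_on lam t /\ indep_on lam (a |: t).
Proof.
move=> indep_a proj_ns t_link; have indep_t := proj_ns t t_link.
move: t_link; rewrite in_link1 => /and3P [_ _ a_t].
by split; [apply: indep_on_of_mod indep_t | apply: indep_on_setU1].
Qed.

Lemma proj_DJ_equiv_set1 K a lam lam' :
  indep_on lam [set a] -> proj_DJ_equiv K [set a] lam lam' ->
  exists g (e : T -> 'F_2), [/\ g \in unitmx, lam a *m g = lam' a &
    {in a |: vertices (link K [set a]), forall x, lam' x = lam x *m g + e x *: lam' a}].
Proof.
move=> indep_a [g g_unit [/andP [span_g _] link_g]].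
have g_a : lam a *m g = lam' a.
  have /sub_span_of_set1P [k g_a] : (lam a *m g <= span_of lam' [set a])%MS.
    by apply: submx_trans span_g; rewrite span_of_set1 submxMr ?genmxE.
  have [k0 | /F2_neq0 k1] := eqVneq k 0; last by rewrite g_a k1 scale1r.
  move/eqP: (indep_on_set1_neq0 indep_a); case.
  by rewrite -(mulmxK g_unit (lam a)) g_a k0 scale0r mul0mx.
have /fin_all_exists [e lam'_g] : forall x, exists k : 'F_2,
    x \in a |: vertices (link K [set a]) -> lam' x = lam x *m g + k *: lam' a.
  move=> x; have [-> | neq_xa] := eqVneq x a.
    by exists 0; rewrite g_a scale0r addr0.
  case: (boolP (x \in vertices (link K [set a]))) => [x_link | x_link]; last first.
    by exists 0; rewrite in_setU1 (negbTE neq_xa) (negbTE x_link).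
  have /sub_span_of_set1P [k link_x] := link_g x x_link.
  by exists (- k) => _; rewrite scaleNr -link_x opprB addrC subrK.
by exists g, e.
Qed.

End Projections.

Section Gluing.
Variables (T : finType) (d : nat) (lam lam' : T -> 'rV['F_2]_d) (X : {set T}).

Lemma sum_lam'_of_relation g e z (c : T -> 'F_2) :
  {in X, forall x, lam' x = lam x *m g + e x *: z} ->
  \sum_(x in X) c x *: lam x = 0 ->
  \sum_(x in X) c x *: lam' x = (\sum_(x in X) c x * e x) *: z.
Proof.
move=> lam'_g rel_c.
rewrite (eq_bigr (fun x => (c x *: lam x) *m g + (c x * e x) *: z)); last first.
  by move=> x xX; rewrite lam'_g // scalerDr scalemxAl scalerA.
by rewrite big_split /= -mulmx_suml rel_c mul0mx add0r scaler_suml.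
Qed.

Variables (a b : T) (g1 g2 : 'M['F_2]_d) (e1 e2 : T -> 'F_2).
Hypotheses (aX : a \in X) (bX : b \in X) (neq_ab : a != b).
Hypotheses (indep_ab : indep_on lam [set a; b]).
Hypotheses (g1_unit : g1 \in unitmx) (g1_a : lam a *m g1 = lam' a).
Hypothesis lam'_g1 : {in X, forall x, lam' x = lam x *m g1 + e1 x *: lam' a}.
Hypothesis lam'_g2 : {in X, forall x, lam' x = lam x *m g2 + e2 x *: lam' b}.

Lemma coef1_respects_relations (c : T -> 'F_2) :
  \sum_(x in X) c x *: lam x = 0 -> \sum_(x in X) c x * e1 x = 0.
Proof.
move=> rel_c; pose s1 := \sum_(x in X) c x * e1 x; pose s2 := \sum_(x in X) c x * e2 x.
have s12 : s1 *: lam' a = s2 *: lam' b.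
  by rewrite -(sum_lam'_of_relation lam'_g1 rel_c) (sum_lam'_of_relation lam'_g2 rel_c).
have : ((s1 - s2 * e1 b) *: lam a + (- s2) *: lam b) *m g1 = 0.
  rewrite mulmxDl -!scalemxAl g1_a scalerBl s12 (lam'_g1 bX) scalerDr scalerA.
  by rewrite addrK scaleNr addrN.
move/(canRL (mulmxK g1_unit)); rewrite mul0mx => /(indep_on_set2 neq_ab indep_ab).
by case=> + /eqP; rewrite oppr_eq0 => + /eqP s2_0; rewrite s2_0 mul0r subr0.
Qed.

Lemma coef1_a : e1 a = 0.
Proof.
have lam'_a : lam' a != 0.
  apply/eqP => lam'_a0; have := @indep_on_set2 _ _ lam a b 1 0 neq_ab indep_ab.
  rewrite scale1r scale0r addr0 -(mulmxK g1_unit (lam a)) g1_a lam'_a0 mul0mx.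
  by case=> // /eqP; rewrite oner_eq0.
have /eqP := lam'_g1 aX; rewrite g1_a addrC -subr_eq subrr eq_sym scaler_eq0.
by rewrite (negbTE lam'_a) orbF => /eqP.
Qed.

Lemma DJ_lift_of_projections :
  exists2 g, g \in unitmx & {in X, forall x, lam' x = lam x *m g}.
Proof.
have [f lam_f] := functional_of_relations_in coef1_respects_relations.
have a_f : lam a *m f = 0 by rewrite lam_f // coef1_a raddf0.
exists (g1 + f *m lam' a); last first.
  by move=> x xX; rewrite mulmxDr mulmxA lam_f // mul_scalar_mx -lam'_g1.
have -> : g1 + f *m lam' a = (1%:M + f *m lam a) *m g1.
  by rewrite mulmxDl mul1mx -mulmxA g1_a.
rewrite unitmx_mul g1_unit andbT.
have [] // := @mulmx1_unit _ _ (1%:M + f *m lam a) (1%:M - f *m lam a).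
rewrite mulmxDl mul1mx mulmxBr mulmx1 !mulmxA -(mulmxA f (lam a) f) a_f.
by rewrite mulmx0 mul0mx subr0 subrK.
Qed.

End Gluing.

Section Wedge.
Variables (V : finType) (K : {set {set V}}) (v : V).
Implicit Types (a : {set V}) (b : {set bool}) (s t : {set V + bool}).

Lemma inr_notin_inl a (β : bool) : (inr β \in (inl @: a : {set V + bool})) = false.
Proof. by apply/imsetP => -[]. Qed.

Lemma set_bool_cases b : [\/ b = set0, b = [set false], b = [set true] | b = setT].
Proof.
by case: (boolP (false \in b)) => f_b; case: (boolP (true \in b)) => t_b;
  [apply: Or44 | apply: Or42 | apply: Or43 | apply: Or41];
  apply/setP => -[]; rewrite !inE ?(negbTE f_b) ?(negbTE t_b).
Qed.

Lemma wedgeP s : s \in wedge K v -> exists a b,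
  [/\ s = inl @: a :|: inr @: b, a \in del K v & b \in dI1 \/ a \in link K [set v]].
Proof.
have link_del a : a \in link K [set v] -> a \in del K v.
  by rewrite !inE disjoints1 => /and3P [-> _ ->].
rewrite inE => /orP [] /imset2P [a b a_K b_I ->]; exists a, b; split => //.
- exact: link_del.
- by right.
- by left.
Qed.

Lemma del_wedge a b : a \in del K v -> b \in dI1 -> inl @: a :|: inr @: b \in wedge K v.
Proof. by move=> a_del b_dI; rewrite inE; apply/orP; right; apply: imset2_f. Qed.

Lemma link_wedge a b : a \in link K [set v] -> inl @: a :|: inr @: b \in wedge K v.
Proof.
move=> a_link; rewrite inE; apply/orP; left; apply: imset2_f => //.
by rewrite powersetE subsetT.
Qed.

Lemma set1_dI1 (β : bool) : [set β] \in dI1.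
Proof. by case: β; rewrite !inE eqxx ?orbT. Qed.

Lemma wedge_face_cases s : s \in wedge K v ->
  exists β t, t \in link (wedge K v) [set inr β] /\ (s = t \/ s = inr β |: t).
Proof.
case/wedgeP => a [b [-> a_del b_cases]].
have inl_link β : inl @: a \in link (wedge K v) [set inr β].
  rewrite in_link1 inr_notin_inl andbT; apply/andP; split.
    by rewrite -[inl @: a]setU0 -(imset0 inr) del_wedge // !inE eqxx.
  by rewrite setUC -imset_set1 del_wedge ?set1_dI1.
have [-> | -> | -> | b_T] := set_bool_cases b.
- by exists false, (inl @: a); rewrite imset0 setU0; split; [|left].
- by exists false, (inl @: a); rewrite imset_set1 setUC; split; [|right].
- by exists true, (inl @: a); rewrite imset_set1 setUC; split; [|right].
have a_link : a \in link K [set v].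
  case: b_cases => // b_dI; move: b_dI; rewrite b_T !inE.
  by case/orP => [/orP [] |] /eqP /setP;
    [move/(_ true) | move/(_ true) | move/(_ false)]; rewrite !inE.
exists false, (inl @: a :|: inr @: [set true]); split; last first.
  have setT_bool : [set: bool] = [set false; true] by apply/setP => -[]; rewrite !inE.
  by right; rewrite b_T setT_bool imsetU1 imset_set1 setUCA.
rewrite in_link1 link_wedge //= setUCA -imsetU1 link_wedge //=.
by rewrite in_setU inr_notin_inl imset_set1 in_set1.
Qed.

Lemma wedge_nonsingularP d (lam : V + bool -> 'rV['F_2]_d) :
  indep_on lam [set inr false] -> indep_on lam [set inr true] ->
  nonsingular (wedge K v) lam <->
  proj_nonsingular (wedge K v) [set inr false] lam /\
  proj_nonsingular (wedge K v) [set inr true] lam.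
Proof.
move=> indep1 indep2; split; first by move=> ns; split; apply: nonsingular_proj.
case=> proj1 proj2 s /wedge_face_cases [β [t [t_link s_t]]].
have [indep_t indep_βt] : indep_on lam t /\ indep_on lam (inr β |: t).
  by case: β t_link {s_t} => t_link; apply: proj_nonsingular_indep t_link.
by case: s_t => ->.
Qed.

Hypotheses (K0 : set0 \in K) (K1 : forall x, [set x] \in K).

Lemma new_vertex_wedge (β : bool) : inr β \in vertices (wedge K v).
Proof.
rewrite in_vertices -[[set inr β]]set0U -(imset0 inl) -imset_set1.
by rewrite del_wedge ?set1_dI1 // in_set K0 in_set0.
Qed.

Lemma wedge_vertices_link (β : bool) :
  {subset vertices (wedge K v) <= inr β |: vertices (link (wedge K v) [set inr β])}.
Proof.
move=> x; rewrite in_setU1; have [// | neq_xβ] := eqVneq x (inr β).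
rewrite !in_vertices in_link1 => x_W; rewrite x_W in_set1 eq_sym neq_xβ andbT /=.
case: x x_W neq_xβ => [y | β'] x_W neq_xβ.
- have [a [b [ab_y a_del _]]] := wedgeP x_W.
  have y_a : y \in a.
    have := set11 (inl y : V + bool); rewrite ab_y in_setU.
    by case/orP => /imsetP [y' y'_a []] // ->.
  rewrite setUC -!imset_set1 del_wedge ?set1_dI1 // in_set K1 in_set1 /=.
  by move: a_del; rewrite in_set => /andP [_]; apply: contraNneq => ->.
- rewrite -[_ |: _]set0U -(imset0 inl) -(imset_set1 inr β') -imsetU1 link_wedge //.
  by rewrite in_link1 K0 setU0 K1 in_set0.
Qed.

Lemma wedge_DJ_equiv d (lam lam' : V + bool -> 'rV['F_2]_d) :
  indep_on lam [set inr false; inr true] ->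
  proj_DJ_equiv (wedge K v) [set inr false] lam lam' ->
  proj_DJ_equiv (wedge K v) [set inr true] lam lam' ->
  DJ_equiv (wedge K v) lam lam'.
Proof.
move=> indep12 proj1 proj2.
have indep_new β : indep_on lam [set inr β].
  by apply: indep_onS indep12; case: β; rewrite sub1set !inE eqxx ?orbT.
have [g1 [e1 [g1_unit g1_v1 lam'_g1]]] := proj_DJ_equiv_set1 (indep_new false) proj1.
have [g2 [e2 [_ _ lam'_g2]]] := proj_DJ_equiv_set1 (indep_new true) proj2.
apply: (DJ_lift_of_projections (new_vertex_wedge false) (new_vertex_wedge true)
         _ indep12 g1_unit g1_v1) => //.
- by move=> x /(wedge_vertices_link false); apply: lam'_g1.
- by move=> x /(wedge_vertices_link true); apply: lam'_g2.
Qed.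

End Wedge.

Theorem theorem1p2 (V : finType) (K : {set {set V}}) (n : nat) (v : V) (d : nat) :
  simplicial_complex K ->
  (forall x : V, [set x] \in K) ->
  fan_like K n ->
  v \in vertices K ->
  (n < d)%N ->
  (forall lam lam' : V + bool -> 'rV['F_2]_d,
      indep_on lam [set v1 V] -> indep_on lam [set v2 V] ->
      indep_on lam' [set v1 V] -> indep_on lam' [set v2 V] ->
      indep_on lam [set v1 V; v2 V] ->
      proj_DJ_equiv (wedge K v) [set v1 V] lam lam' ->
      proj_DJ_equiv (wedge K v) [set v2 V] lam lam' ->
      DJ_equiv (wedge K v) lam lam')
  /\
  (forall lam : V + bool -> 'rV['F_2]_d,
      indep_on lam [set v1 V] -> indep_on lam [set v2 V] ->
      (nonsingular (wedge K v) lam <->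
       proj_nonsingular (wedge K v) [set v1 V] lam /\
       proj_nonsingular (wedge K v) [set v2 V] lam)).
Proof.
move=> [K0 _] K1 _ _ _; split.
- by move=> lam lam' _ _ _ _ indep12; apply: (wedge_DJ_equiv K0 K1).
- by move=> lam indep1 indep2; apply: wedge_nonsingularP.
Qed.
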